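(* There exists a deterministic distributed algorithm that solves $\mathrm{DenseSubgraph}(\tilde{D}, \epsilon)$ (for any given $\tilde D \ge 0$ and $0<\epsilon<1$) in $O((\log n)/\epsilon)$ rounds in the LOCAL model.
   Context: Let $G=(V,E)$ be a simple undirected graph with $n$ vertices, which is both the input graph and the communication network. For a subgraph $H$, its density is $d(H)=|E(H)|/|V(H)|$, and $D=\max_{H\subseteq G} d(H)$ is the maximum subgraph density. In the LOCAL model, vertices have unique IDs and operate in synchronous rounds; in each round every vertex sends a message of arbitrary size to each neighbor, receives messages from its neighbors, and performs arbitrary local computation; the complexity is the number of rounds. Problem $\mathrm{DenseSubgraph}(\tilde{D}, \epsilon)$: given $G$, a parameter $\tilde D\ge 0$ and $0<\epsilon<1$, every vertex $u$ outputs $h_u\in\{0,1\}$ such that the subgraph $H$ induced by $\{u : h_u=1\}$ satisfies $d(H)\ge(1-\epsilon)\tilde D$; moreover, if $\tilde D\le D$ then $H$ must be non-empty. *)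

(* Defs.v *)
From HB Require Import structures.
From mathcomp Require Import all_boot all_order all_algebra.
From mathcomp Require Import reals.
Set Implicit Arguments.
Unset Strict Implicit.
Unset Printing Implicit Defensive.
Import Order.TTheory GRing.Theory Num.Theory.
Local Open Scope ring_scope.

Record simple_graph := SimpleGraph {
  vertex :> finType;
  adj : rel vertex;
  adj_sym : symmetric adj;
  adj_irr : irreflexive adj }.

Definition edges (G : simple_graph) : {set {set G}} :=
  [set [set p.1; p.2] | p : G * G & adj p.1 p.2].

(* A pair (vertex set, edge set); subgraphs need not be induced. *)
Definition subgraph (G : simple_graph) (H : {set G} * {set {set G}}) : bool :=
  [forall f in H.2, (f \in edges G) && (f \subset H.1)].

Definition induced (G : simple_graph) (S : {set G}) :
    {set G} * {set {set G}} :=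
  (S, [set f in edges G | f \subset S]).

Definition density (R : realType) (G : simple_graph)
    (H : {set G} * {set {set G}}) : R :=
  #|H.2|%:R / #|H.1|%:R.

(* Densities are nonnegative, so the default value 0 is harmless as soon as
   G has a vertex. *)
Definition max_density (R : realType) (G : simple_graph) : R :=
  \big[Num.max/0]_(H : {set G} * {set {set G}} | subgraph H && (H.1 != set0))
    density R H.

(* The density of the graph without vertices is 0 / 0, so the lower bound is
   required of non-empty H only: for Dt > D the answer may have to be empty. *)
Definition dense_subgraph_solution (R : realType) (G : simple_graph)
    (Dt eps : R) (h : G -> bool) : Prop :=
  let H := induced [set u | h u] in
  (H.1 != set0 -> (1 - eps) * Dt <= density R H) /\
  (Dt <= max_density R G -> H.1 != set0).

(* Identifiers are arbitrary distinct naturals; [port v] lists the neighbours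
   of v in an arbitrary order, the i-th one being reached through port i. *)
Record network (G : simple_graph) := Network {
  ident : G -> nat;
  ident_inj : injective ident;
  port : G -> seq G;
  port_uniq : forall v, uniq (port v);
  mem_port : forall v w, (w \in port v) = adj v w }.

(* Deterministic algorithms in the LOCAL model with input type I and output
   type O. A vertex starts from its input, its identifier and its degree.
   [send s i] is the message sent through port i; [receive] gets the incoming
   messages in the order of the ports. States, messages and local computations
   are unrestricted. *)
Record local_algorithm (I O : Type) := LocalAlgorithm {
  state : Type;
  message : Type;
  init : I -> nat -> nat -> state;
  send : state -> nat -> message;
  receive : state -> seq message -> state;
  output : state -> O }.

(* A message from w to v leaves through the port of w that leads to v. *)
Fixpoint state_after (I O : Type) (A : local_algorithm I O)
    (G : simple_graph) (N : network G) (input : G -> I) (t : nat) (v : G) :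
    state A :=
  match t with
  | 0 => init A (input v) (ident N v) (size (port N v))
  | t'.+1 =>
      receive (state_after A N input t' v)
        [seq send (state_after A N input t' w) (index v (port N w))
           | w <- port N v]
  end.

Definition output_after (I O : Type) (A : local_algorithm I O)
    (G : simple_graph) (N : network G) (input : G -> I) (t : nat) (v : G) : O :=
  output (state_after A N input t v).

(* The common input of all vertices: the number n of vertices of the network
   and the parameters Dt and eps. *)
Definition dense_subgraph_input (R : realType) : Type := (nat * R * R)%type.

(* [rounds n Dt eps] is the number of rounds after which all vertices stop. *)
Definition solves_dense_subgraph (R : realType)
    (A : local_algorithm (dense_subgraph_input R) bool)
    (rounds : nat -> R -> R -> nat) : Prop :=
  forall (G : simple_graph) (N : network G) (Dt eps : R),
    (0 < #|G|)%N -> 0 <= Dt -> 0 < eps < 1 ->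
    dense_subgraph_solution Dt eps
      (output_after A N (fun=> (#|G|, Dt, eps)) (rounds #|G| Dt eps)).

(* Main.v *)
(** Put [f(S) = 2 |E(S)| - 2 (1 - eps) Dt |S|] and call [S] stable if [f] is
    nowhere larger on subsets of [S]. As [f] is supermodular, stable sets are
    closed under union, and [f >= 0] on them because [f(set0) = 0]. The output
    is the union of all stable sets contained in some ball of radius
    [r = ceil (ln n / eps)]: its density is at least [(1 - eps) Dt], and each
    vertex can decide membership from the part of the graph near it.

    If [Dt <= D] this union is not empty. Let [U] be a set of maximum density,
    [c] in [U], and [X i] the set of vertices of [U] at distance at most [i]
    from [c]. At least [D |X i|] edges of [U] touch [X i], and they all lie in
    [X (i + 1)]. Hence [X (i + 1)] has density at least [(1 - eps) D] unless
    [|X i| < (1 - eps) |X (i + 1)|], and the latter cannot hold for all [i < r]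
    unless [X r = U]. A nonempty maximizer of [f] among the subsets of the
    dense [X i] is stable. *)
Require Import Defs.
From mathcomp Require Import all_boot all_order all_algebra.
From mathcomp Require Import boolp reals sequences exp.
From mathcomp Require Import lra zify.
Set Implicit Arguments.
Unset Strict Implicit.
Unset Printing Implicit Defensive.
Import Order.TTheory GRing.Theory Num.Theory.
Local Open Scope ring_scope.

(** * Walks of bounded length *)

Definition within (T : eqType) (e : rel T) (r : nat) (x y : T) : Prop :=
  exists2 p, path e x p /\ last x p = y & (size p <= r)%N.

Lemma within_refl (T : eqType) (e : rel T) r x : within e r x x.
Proof. by exists [::]. Qed.

Lemma within_mono (T : eqType) (e : rel T) r s x y :
  (r <= s)%N -> within e r x y -> within e s x y.
Proof. by move=> rs [p pP pr]; exists p => //; apply: leq_trans rs. Qed.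

Lemma within_step (T : eqType) (e : rel T) r x y z :
  within e r x y -> e y z -> within e r.+1 x z.
Proof.
move=> [p [pP <-] pr] eyz; exists (rcons p z); last by rewrite size_rcons.
by rewrite rcons_path pP last_rcons.
Qed.

Lemma within_trans (T : eqType) (e : rel T) r s x y z :
  within e r x y -> within e s y z -> within e (r + s) x z.
Proof.
move=> [p [pP <-] pr] [q [qP <-] qs]; exists (p ++ q).
  by rewrite cat_path pP qP last_cat.
by rewrite size_cat leq_add.
Qed.

Lemma within_sym (T : eqType) (e : rel T) r x y :
  symmetric e -> within e r x y -> within e r y x.
Proof.
move=> es [p [pP <-] pr]; exists (rev (belast x p)); last first.
  by rewrite size_rev size_belast.
split; first by rewrite rev_path (eq_path (e' := e)).
by case: p {pP pr} => //= a p; rewrite rev_cons last_rcons.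
Qed.

(** Every prefix of a short walk from [c] is again one, so [h] has to preserve only the arcs that
    start near [c]. *)
Lemma within_map (T T' : eqType) (e : rel T) (e' : rel T') (h : T -> T') r c x :
  (forall y z, within e r c y -> e y z -> e' (h y) (h z)) ->
  within e r c x -> within e' r (h c) (h x).
Proof.
move=> he [p [pP <-] pr]; exists (map h p); last by rewrite size_map.
split; last by rewrite last_map.
elim/last_ind: p pP pr => [//|p z IH].
rewrite rcons_path size_rcons map_rcons rcons_path last_map => /andP[pP ez] pr.
rewrite IH ?(ltnW pr) //=; apply: he => //; exists p => //; exact: ltnW.
Qed.

(** * Arc counts, excess and stable sets *)

Definition arcs (T : eqType) (e : rel T) (s : seq T) : nat :=
  \sum_(x <- s) \sum_(y <- s) e x y.

Lemma perm_arcs (T : eqType) (e : rel T) s t :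
  perm_eq s t -> arcs e s = arcs e t.
Proof.
by move=> st; rewrite /arcs (perm_big _ st); apply: eq_bigr => x _; exact: perm_big.
Qed.

Lemma arcs_map (T T' : eqType) (e : rel T) (e' : rel T') (h : T -> T') s :
  {in s &, forall x y, e' (h x) (h y) = e x y} ->
  arcs e' (map h s) = arcs e s.
Proof.
move=> he; rewrite /arcs big_map; apply: eq_big_seq => x xs.
by rewrite big_map; apply: eq_big_seq => y ys; rewrite he.
Qed.

(* [e] being symmetric, each edge gives two arcs: a set of density [k / 2] has
   excess [0]. *)
Definition excess (R : realType) (T : eqType) (e : rel T) (k : R) (s : seq T) : R :=
  (arcs e s)%:R - k * (size s)%:R.

Definition stable (R : realType) (T : eqType) (e : rel T) (k : R) (s : seq T) : Prop :=
  forall t, uniq t -> {subset t <= s} -> excess e k t <= excess e k s.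

(** Sequences over an [eqType] stand for finite sets because a vertex evaluates this predicate on
    identifiers in [nat]. The centre [c] may differ from [a]; both being within [r] of [c], all of
    [s] lies within [2 r] of [a]. *)
Definition detected (R : realType) (T : eqType) (e : rel T) (r : nat) (k : R)
    (a : T) : Prop :=
  exists c s, [/\ uniq s, a \in s, stable e k s &
    forall x, x \in s -> within e r c x].

Lemma perm_excess (R : realType) (T : eqType) (e : rel T) (k : R) s t :
  perm_eq s t -> excess e k s = excess e k t.
Proof. by move=> st; rewrite /excess (perm_arcs e st) (perm_size st). Qed.

Lemma excess_map (R : realType) (T T' : eqType) (e : rel T) (e' : rel T')
    (h : T -> T') (k : R) s :
  {in s &, forall x y, e' (h x) (h y) = e x y} ->
  excess e' k (map h s) = excess e k s.
Proof. by move=> he; rewrite /excess (arcs_map he) size_map. Qed.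

(** * Locality of detection *)

Section Locality.
Variables (R : realType) (T : finType) (T' : eqType) (e : rel T) (e' : rel T').
Variables (h : T -> T') (r : nat) (k : R) (a : T).
Hypotheses (es : symmetric e) (h_inj : injective h).
Hypothesis e'_sound :
  forall i j, e' i j -> exists x y, [/\ i = h x, j = h y & e x y].
Hypothesis e'_complete :
  forall x y, within e r.*2 a x -> e x y -> e' (h x) (h y).

Let e'h x y : e' (h x) (h y) -> e x y.
Proof. by move=> /e'_sound[x' [y' [/h_inj-> /h_inj->]]]. Qed.

Let e'E x y : within e r.*2 a x -> e' (h x) (h y) = e x y.
Proof. by move=> ax; apply/idP/idP => [/e'h//|]; exact: e'_complete. Qed.

(** Any witness lies within [2 r] of [a], where [e] and [e'] agree through [h], so it has the same
    excess on both sides, and so have its subsets. Conversely, walks of [e'] lift to [e] because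
    every arc of [e'] is the image of an arc of [e]. *)
Lemma detected_local : detected e r k a <-> detected e' r k (h a).
Proof.
have lift (t : seq T') : {subset t <= codom h} -> exists t0, t = map h t0.
  elim: t => [|i t IH] sub; first by exists [::].
  have /codomP[x ->] := sub i (mem_head _ _).
  have [|t0 ->] := IH; first by move=> j jt; apply: sub; rewrite inE jt orbT.
  by exists (x :: t0).
have far c (s : seq T) : a \in s -> (forall x, x \in s -> within e r c x) ->
    forall x, within e r c x -> within e r.*2 a x.
  move=> sa sc x cx; rewrite -addnn; apply: within_trans cx.
  exact: within_sym (sc _ sa).
split.
- move=> [c [s [us sa st sc]]]; exists (h c), (map h s); split.
  + by rewrite map_inj_uniq.
  + exact: map_f.
  + move=> t ut tsub.
    have [|t0 E] := lift t.
      by move=> i /tsub /mapP[x _ ->]; exact: codom_f.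
    have sub0 : {subset t0 <= s}.
      move=> x xt; have := tsub (h x); rewrite E map_f // => /(_ isT).
      by rewrite mem_map.
    have ag (u : seq T) : {subset u <= s} -> excess e' k (map h u) = excess e k u.
      by move=> us'; apply: excess_map => x y /us' xs _; apply: e'E;
         apply: (far _ _ sa sc); exact: sc.
    rewrite E !ag //; apply: st => //; move: ut; rewrite E; exact: map_uniq.
  + move=> _ /mapP[x xs ->]; apply: within_map (sc _ xs) => y z cy yz.
    by apply: e'_complete yz; apply: (far _ _ sa sc).
- move=> [c' [s' [us sa st sc]]].
  (* The walk from [c'] to [h a] is either empty, and then [c'] is [h a], or begins with an arc
     leaving [c'], to which [e'_sound] applies. *)
  have [c cE] : exists c, c' = h c.
    have [[|i p] [/= pP pl] _] := sc _ sa; first by exists a.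
    by move: pP => /andP[/e'_sound[x [y [-> _ _]]] _]; exists x.
  rewrite {}cE in sc.
  have down x' : within e' r (h c) x' -> exists2 x, x' = h x & within e r c x.
    have path_lift q : path e' (h c) q -> exists2 q0, q = map h q0 & path e c q0.
      elim/last_ind: q => [|q w IHq]; first by exists [::].
      rewrite rcons_path => /andP[/IHq[q0 -> q0P]].
      rewrite last_map => /e'_sound[u [v [/h_inj uE -> uv]]].
      by exists (rcons q0 v); rewrite ?map_rcons // rcons_path q0P uE.
    move=> [p [/path_lift[q -> qP] <-]]; rewrite size_map last_map => qr.
    by exists (last c q) => //; exists q.
  have [|s E] := lift s'.
    by move=> i /sc/down[x -> _]; rewrite codom_f.
  have sc0 x : x \in s -> within e r c x.
    move=> xs; have [|y /h_inj ->//] := down (h x).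
    by apply: sc; rewrite E map_f.
  have sa0 : a \in s by move: sa; rewrite E mem_map.
  have ag (u : seq T) : {subset u <= s} -> excess e' k (map h u) = excess e k u.
    by move=> us'; apply: excess_map => x y /us' xs _; apply: e'E;
       apply: (far _ _ sa0 sc0); exact: sc0.
  exists c, s; split=> //.
  + by move: us; rewrite E; exact: map_uniq.
  + move=> t ut tsub; rewrite -!ag //; rewrite E in st; apply: st.
      by rewrite map_inj_uniq.
    by move=> _ /mapP[x /tsub xs ->]; exact: map_f.
Qed.

End Locality.

(** * Supermodularity and unions of stable sets *)

Section FiniteExcess.
Variables (R : realType) (T : finType) (e : rel T).
Implicit Types (k : R) (A B U : {set T}).

Lemma arcs_enum A :
  arcs e (enum A) = (\sum_x \sum_y (x \in A) * (y \in A) * e x y)%N.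
Proof.
rewrite /arcs big_enum [RHS](bigID (mem A)) /= [X in _ = (_ + X)%N]big1.
  rewrite addn0; apply: eq_bigr => x xA.
  rewrite big_enum [RHS](bigID (mem A)) /= [X in _ = (_ + X)%N]big1.
    by rewrite addn0; apply: eq_bigr => y yA; rewrite xA yA !mul1n.
  by move=> y /negbTE ->; rewrite muln0.
by move=> x /negbTE ->; rewrite big1.
Qed.

Lemma arcs_enum0 : arcs e (enum (set0 : {set T})) = 0%N.
Proof. by rewrite enum_set0 /arcs big_nil. Qed.

(** The inequality holds arc by arc: an arc inside both sets lies in their intersection and in their
    union, an arc inside only one of them lies in the union. *)
Lemma arcs_supermodular A B :
  (arcs e (enum A) + arcs e (enum B) <=
   arcs e (enum (A :|: B)) + arcs e (enum (A :&: B)))%N.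
Proof.
rewrite !arcs_enum -!big_split; apply: leq_sum => x _.
rewrite -!big_split; apply: leq_sum => y _; rewrite /= !inE.
by case: (x \in A); case: (x \in B); case: (y \in A); case: (y \in B); case: (e x y).
Qed.

Lemma excess_supermodular k A B :
  excess e k (enum A) + excess e k (enum B) <=
  excess e k (enum (A :|: B)) + excess e k (enum (A :&: B)).
Proof.
rewrite /excess -!cardE.
have := arcs_supermodular A B; rewrite -(ler_nat R) !natrD => H.
have : #|A :|: B|%:R + #|A :&: B|%:R = #|A|%:R + #|B|%:R :> R.
  by rewrite -!natrD cardsUI.
move=> /(congr1 (fun z => k * z)); rewrite !mulrDr => H2; lra.
Qed.

Lemma excess0 k : excess e k (enum (set0 : {set T})) = 0.
Proof. by rewrite /excess arcs_enum0 -cardE cards0 mulr0 subr0. Qed.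

Lemma stable_enumP k A :
  stable e k (enum A) <->
  forall B, B \subset A -> excess e k (enum B) <= excess e k (enum A).
Proof.
split=> [st B BA | st t ut tA].
  apply: st; first exact: enum_uniq.
  by move=> x; rewrite !mem_enum; apply/subsetP.
have p : perm_eq t (enum [set x in t]).
  by apply: uniq_perm => // [|x]; rewrite ?enum_uniq // mem_enum inE.
rewrite (perm_excess _ _ p); apply: st; apply/subsetP => x.
by rewrite inE => /tA; rewrite mem_enum.
Qed.

(** Adding [A] to a subset [C] of the union changes the excess by at least that of [A] minus that of
    [C :&: A], which is nonnegative by stability of [A]. Adding [B] afterwards works the same way
    and reaches the whole union. *)
Lemma stableU k A B :
  stable e k (enum A) -> stable e k (enum B) -> stable e k (enum (A :|: B)).
Proof.
move=> /stable_enumP sA /stable_enumP sB; apply/stable_enumP => C CAB.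
have H1 := excess_supermodular k C A.
have H2 := excess_supermodular k (C :|: A) B.
have H3 := sA (C :&: A) (subsetIr _ _).
have H4 := sB ((C :|: A) :&: B) (subsetIr _ _).
have E : C :|: A :|: B = A :|: B by rewrite -setUA; apply/setUidPr.
rewrite E in H2; lra.
Qed.

Lemma detected_enumP r k a :
  detected e r k a <-> exists c A, [/\ a \in A, stable e k (enum A) &
    forall x, x \in A -> within e r c x].
Proof.
split=> [[c [s [us sa st sc]]]|[c [A [Aa st Ac]]]].
  exists c, [set x in s]; split; first by rewrite inE.
    have p : perm_eq s (enum [set x in s]).
      by apply: uniq_perm => // [|x]; rewrite ?enum_uniq // mem_enum inE.
    move=> t ut tsub; rewrite -(perm_excess _ _ p); apply: st => // x /tsub.
    by rewrite mem_enum inE.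
  by move=> x; rewrite inE; exact: sc.
exists c, (enum A); split; rewrite ?enum_uniq ?mem_enum //.
by move=> x; rewrite mem_enum; exact: Ac.
Qed.

Lemma excess_detected_ge0 r k :
  0 <= excess e k (enum [set v | `[< detected e r k v >]]).
Proof.
set H := [set v | _].
pose C := [set A : {set T} | `[< stable e k (enum A) /\
  exists c, forall x, x \in A -> within e r c x >]].
have -> : H = \bigcup_(A in C) A.
  apply/setP => v; rewrite inE; apply/asboolP/bigcupP.
    move=> /detected_enumP[c [A [Av st Ac]]]; exists A => //.
    by rewrite inE; apply/asboolP; split=> //; exists c.
  move=> [A]; rewrite inE => /asboolP[st [c Ac]] vA.
  by apply/detected_enumP; exists c, A.
have : stable e k (enum (\bigcup_(A in C) A)).
  apply: (big_ind (fun B => stable e k (enum B))).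
  - by apply/stable_enumP => B; rewrite subset0 => /eqP ->.
  - exact: stableU.
  - by move=> A; rewrite inE => /asboolP[].
by move=> /stable_enumP /(_ set0 (sub0set _)); rewrite excess0.
Qed.

Lemma detected_ex r k c A :
  A != set0 -> (forall x, x \in A -> within e r c x) ->
  0 <= excess e k (enum A) -> exists v, detected e r k v.
Proof.
move=> A0 Ac fA.
have P0 : (A != set0) && (A \subset A) by rewrite A0 subxx.
case: (@arg_maxP _ _ _ _ (fun B => (B != set0) && (B \subset A))
  (fun B => excess e k (enum B)) P0) => B /andP[/set0Pn[v vB] BA] Bmax.
exists v; apply/detected_enumP; exists c, B; split=> //; last first.
  by move=> x /(subsetP BA); exact: Ac.
apply/stable_enumP => D DB.
(* [B] is maximal among nonempty subsets only; the empty one is compared through [A], whose excess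
   is nonnegative. *)
have [->|D0] := eqVneq D set0.
  by rewrite excess0; apply: le_trans fA _; apply: Bmax.
by apply: Bmax; rewrite D0 (subset_trans DB).
Qed.

(** * Growth of balls inside a densest set *)

Definition ball c i : {set T} := [set x | `[< within e i c x >]].

Section Growth.
Variables (D : R) (U : {set T}) (c : T).
Hypotheses (e_sym : symmetric e) (D_ge0 : 0 <= D) (cU : c \in U).
Hypothesis U_dense : (arcs e (enum U))%:R = D * #|U|%:R.
Hypothesis D_max : forall A, (arcs e (enum A))%:R <= D * #|A|%:R.

(* Deleting [U :&: ball c i] from [U] does not raise the density, so at least
   [D * #|U :&: ball c i|] arcs touch this set, and all of them lie within
   [ball c i.+1]. *)
Lemma arcs_ball i :
  D * #|U :&: ball c i|%:R <= (arcs e (enum (U :&: ball c i.+1)))%:R.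
Proof.
have sub x : x \in ball c i -> x \in ball c i.+1.
  by rewrite !inE => /asboolP H; apply/asboolP; apply: within_mono H.
have stp x y : x \in ball c i -> e x y -> y \in ball c i.+1.
  by rewrite !inE => /asboolP H xy; apply/asboolP; apply: within_step xy.
(* An arc of [U] either avoids [ball c i] at both ends or has an end in it, and then [sub] and [stp]
   put both ends in [ball c i.+1]. *)
have H : (arcs e (enum U) <= arcs e (enum (U :&: ball c i.+1)) +
                             arcs e (enum (U :\: ball c i)))%N.
  rewrite !arcs_enum -big_split; apply: leq_sum => x _.
  rewrite -big_split; apply: leq_sum => y _; rewrite /= !in_setI !in_setD.
  case xy : (e x y); last by rewrite !muln0.
  have yx : e y x by rewrite e_sym.
  have := stp x y ^~ xy; have := stp y x ^~ yx.
  have := sub x; have := sub y.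
  case: (x \in U); case: (y \in U) => //=.
  by case: (x \in ball c i); case: (y \in ball c i);
     case: (x \in ball c i.+1); case: (y \in ball c i.+1) => // A1 A2 A3 A4;
     try (by have := A1 isT); try (by have := A2 isT);
     try (by have := A3 isT); try (by have := A4 isT).
rewrite -(ler_nat R) natrD U_dense in H.
have H2 := D_max (U :\: ball c i).
have : #|U|%:R = #|U :&: ball c i|%:R + #|U :\: ball c i|%:R :> R.
  by rewrite -natrD cardsID.
by move=> E; rewrite E mulrDr in H; lra.
Qed.

Lemma dense_ball (eps : R) r :
  0 < eps < 1 -> #|T|%:R <= expR (eps * r%:R) ->
  exists2 i, (i <= r)%N &
    (1 - eps) * D * #|U :&: ball c i|%:R <= (arcs e (enum (U :&: ball c i)))%:R.
Proof.
move=> /andP[e0 e1] nr.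
have d0 : 0 < 1 - eps by rewrite subr_gt0.
(* As long as no dense ball is met, each step multiplies the size by more than [1 / (1 - eps)],
   starting from a set that contains [c]. *)
have grow j : (exists2 i, (i <= j)%N &
    (1 - eps) * D * #|U :&: ball c i|%:R <= (arcs e (enum (U :&: ball c i)))%:R)
    \/ 1 <= (1 - eps) ^+ j * #|U :&: ball c j|%:R.
  elim: j => [|j [[i ij iP]|IH]]; last 1 first.
  - have [le|lt] := leP ((1 - eps) * #|U :&: ball c j.+1|%:R) #|U :&: ball c j|%:R.
      left; exists j.+1 => //; apply: le_trans (arcs_ball j).
      by rewrite -mulrA mulrCA ler_wpM2l.
    right; apply: le_trans IH _; rewrite exprSr -mulrA ler_wpM2l ?exprn_ge0 //.
      exact: ltW.
    exact: ltW.
  - right; rewrite expr0 mul1r ler1n card_gt0; apply/set0Pn; exists c.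
    by rewrite !inE cU; apply/asboolP; exact: within_refl.
  - by left; exists i => //; exact: leqW.
have [//|big] := grow r.
exists r => //.
(* Since [1 - eps <= expR (- eps)], the product of [(1 - eps) ^+ r] and [#|T|] is at most 1. By
   [big], the last set then has at least [#|T|] elements and must be all of [U]. *)
suff -> : U :&: ball c r = U by rewrite U_dense -mulrA ler_piMl ?mulr_ge0//; lra.
apply/eqP; rewrite eqEcard subsetIl /=; apply: leq_trans (max_card _) _.
rewrite -(ler_nat R) -(ler_pM2l (exprn_gt0 r d0)); apply: le_trans big.
apply: le_trans (ler_wpM2l (exprn_ge0 _ (ltW d0)) nr) _.
rewrite mulrC [eps * _]mulrC expRM_natl -exprMn -[leRHS](expr1n _ r).
apply: lerXn2r; rewrite ?nnegrE ?mulr_ge0 ?expR_ge0 ?ler01 ?(ltW d0) //.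
have := expR_ge1Dx (- eps); rewrite expRN => H.
by rewrite -[leRHS](mulfV (lt0r_neq0 (expR_gt0 eps))) ler_wpM2l ?expR_ge0.
Qed.

End Growth.
End FiniteExcess.

(** * Arc counts and densities of induced subgraphs *)

(** Each edge [[set x; y]] comes from exactly the two arcs [(x, y)] and [(y, x)], which differ
    because [adj] is irreflexive. *)
Lemma arcs_induced (G : simple_graph) (S : {set G}) :
  arcs (@adj G) (enum S) = (2 * #|(induced S).2|)%N.
Proof.
pose P := [set p : G * G | [&& p.1 \in S, p.2 \in S & adj p.1 p.2]].
have -> : (induced S).2 = [set [set p.1; p.2] | p in P].
  apply/setP => f; rewrite !inE; apply/andP/imsetP.
    move=> [/imsetP[p + ->] /subsetP sS]; rewrite inE => pa; exists p => //.
    by rewrite inE !sS ?inE ?eqxx ?orbT.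
  move=> [p]; rewrite inE => /and3P[p1 p2 pa] ->; split.
    by apply/imsetP; exists p; rewrite ?inE.
  by apply/subsetP => x; rewrite !inE => /orP[] /eqP ->.
have -> : arcs (@adj G) (enum S) = #|P|.
  rewrite arcs_enum pair_big /= -sum1_card [RHS]big_mkcond /=.
  apply: eq_bigr => p _; rewrite inE.
  by case: (p.1 \in S); case: (p.2 \in S); case: (adj p.1 p.2).
rewrite -sum1_card (partition_big_imset (fun p : G * G => [set p.1; p.2])) /=.
rewrite mulnC -sum_nat_const /=.
apply: eq_bigr => f /imsetP[[x y]]; rewrite inE /= => /and3P[xS yS xy] ->.
have nxy : x != y by apply/eqP => E; rewrite E adj_irr in xy.
rewrite (eq_bigl (mem [set (x, y); (y, x)])) => [|[u v]].
  by rewrite sum1_card cards2 xpair_eqE negb_and nxy.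
rewrite !inE !xpair_eqE /=; apply/andP/orP.
  move=> [/and3P[_ _ uv] /eqP E].
  have : u \in [set x; y] by rewrite -E !inE eqxx.
  have : v \in [set x; y] by rewrite -E !inE eqxx orbT.
  have nuv : u != v by apply/eqP => E'; rewrite E' adj_irr in uv.
  rewrite !inE => /orP[] /eqP vE /orP[] /eqP uE; move: nuv; rewrite vE uE ?eqxx //;
    by [left|right].
case=> /andP[/eqP -> /eqP ->]; split=> //; first by rewrite xS yS xy.
  by rewrite xS yS adj_sym xy.
by rewrite setUC.
Qed.

Lemma excess_density (R : realType) (G : simple_graph) (d : R) (S : {set G}) :
  S != set0 ->
  (0 <= excess (@adj G) (2 * d) (enum S)) = (d <= density R (induced S)).
Proof.
move=> S0; rewrite /excess arcs_induced -cardE natrM -mulrA -mulrBr.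
rewrite pmulr_rge0 // subr_ge0 /density /= ler_pdivlMr //.
by rewrite ltr0n card_gt0.
Qed.

(** Passing from a subgraph to the one induced on the same vertices only adds edges, so induced
    subgraphs attain the maximum. *)
Lemma densest (R : realType) (G : simple_graph) : (0 < #|G|)%N ->
  exists2 U : {set G}, U != set0 & max_density R G <= density R (induced U) /\
    forall S : {set G}, S != set0 ->
      density R (induced S) <= density R (induced U).
Proof.
move=> G0; have T0 : [set: G] != set0 by rewrite -card_gt0 cardsT.
case: (@arg_maxP _ _ _ _ (fun S : {set G} => S != set0)
  (fun S => density R (induced S)) T0) => U U0 Umax.
exists U => //; split=> //; apply: bigmax_le.
  by rewrite /density divr_ge0.
move=> [S F] /andP[/= /forallP sub S0]; apply: le_trans (Umax S S0).
rewrite /density /= ler_wpM2r ?invr_ge0 // ler_nat; apply: subset_leq_card.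
apply/subsetP => f fF; have := sub f; rewrite /= fF /= => /andP[fG fS].
by rewrite !inE fG.
Qed.

(** * The radius and correctness of the detected set *)

Definition radius (R : realType) (n : nat) (eps : R) : nat :=
  `|Num.ceil (ln n%:R / eps)|%N.

Lemma radius_ge (R : realType) n (eps : R) :
  ln n%:R / eps <= (radius n eps)%:R.
Proof.
apply: le_trans (ceil_ge _) _.
by rewrite /radius natr_absz ler_int ler_norm.
Qed.

Lemma radius_lt (R : realType) n (eps : R) : (0 < n)%N -> 0 < eps ->
  (radius n eps)%:R < ln n%:R / eps + 1.
Proof.
move=> n0 e0; rewrite /radius natr_absz ger0_norm; last first.
  by rewrite ceil_ge0 (lt_le_trans (ltrN10 _)) // divr_ge0 ?ln_ge0 ?ler1n // ltW.
by have := ceilB1_lt (ln n%:R / eps); rewrite intrB ltrBlDr.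
Qed.

Lemma detected_solution (R : realType) (G : simple_graph) (Dt eps : R) :
  (0 < #|G|)%N -> 0 < eps < 1 ->
  dense_subgraph_solution Dt eps (fun v : G =>
    `[< detected (@adj G) (radius #|G| eps) (2 * ((1 - eps) * Dt)) v >]).
Proof.
move=> G0 eps01; have /andP[e0 e1] := eps01.
split=> [H0|DtD]; first by rewrite -excess_density // excess_detected_ge0.
have [U U0 [DU Umax]] := densest R G0.
have /set0Pn[c cU] := U0.
set d := density R (induced U) in DU Umax.
have arcsE (S : {set G}) : S != set0 ->
    (arcs (@adj G) (enum S))%:R = 2 * density R (induced S) * #|S|%:R.
  move=> S0; rewrite arcs_induced natrM -mulrA /density /= divfK //.
  by rewrite pnatr_eq0 cards_eq0.
(* [dense_ball] counts arcs, so the role of its [D] is played by twice the maximum density. *)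
have d0 : 0 <= 2 * d by rewrite mulr_ge0 // /d /density divr_ge0.
have Dmax (S : {set G}) : (arcs (@adj G) (enum S))%:R <= 2 * d * #|S|%:R.
  have [->|S0] := eqVneq S set0; first by rewrite arcs_enum0 cards0 mulr0.
  by rewrite arcsE // ler_wpM2r // ler_wpM2l // Umax.
have nr : #|G|%:R <= expR (eps * (radius #|G| eps)%:R).
  have n0 : 0 < #|G|%:R :> R by rewrite ltr0n.
  rewrite -{1}(lnK (x := #|G|%:R)) ?posrE // ler_expR mulrC -ler_pdivrMr //.
  exact: radius_ge.
have [i ir iP] := dense_ball (@adj_sym G) d0 cU (arcsE _ U0) Dmax eps01 nr.
have X0 : U :&: ball (@adj G) c i != set0.
  by apply/set0Pn; exists c; rewrite !inE cU; apply/asboolP; exact: within_refl.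
have [||v vP] := @detected_ex R G (@adj G) (radius #|G| eps)
    (2 * ((1 - eps) * Dt)) c _ X0.
- by move=> x; rewrite !inE => /andP[_ /asboolP]; exact: within_mono.
- rewrite /excess -cardE subr_ge0; apply: le_trans iP.
  rewrite ler_wpM2r // mulrCA ler_wpM2l ?subr_ge0 ?(ltW e1) //.
  by rewrite ler_wpM2l // (le_trans DtD).
by apply/set0Pn; exists v; rewrite inE; apply/asboolP.
Qed.

(** * Gathering the neighbourhood by message passing *)

(* A state consists of the input, the own identifier, and the arcs learned so
   far, as pairs of identifiers. *)
Definition gathering_algorithm (R : realType) :
    local_algorithm (dense_subgraph_input R) bool :=
  @LocalAlgorithm (dense_subgraph_input R) bool
    (dense_subgraph_input R * nat * seq (nat * nat)) (nat * seq (nat * nat))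
    (fun input a _ => (input, a, [::]))
    (fun s _ => (s.1.2, s.2))
    (fun s ms => (s.1, flatten [seq (s.1.2, m.1) :: m.2 | m <- ms]))
    (fun s => let: (n, Dt, eps, a, known) := s in
      `[< detected (fun i j => (i, j) \in known) (radius n eps)
            (2 * ((1 - eps) * Dt)) a >]).

Section Gathering.
Variables (R : realType) (G : simple_graph) (N : network G).
Variable input : G -> dense_subgraph_input R.
Let st := state_after (gathering_algorithm R) N input.

Lemma gathered_own t v : (st t v).1 = (input v, ident N v).
Proof. by elim: t. Qed.

Lemma gathered_sound t v i j : (i, j) \in (st t v).2 ->
  exists x y, [/\ i = ident N x, j = ident N y & adj x y].
Proof.
elim: t v => [//|t IH] v.
rewrite /st /= -/st -map_comp => /flatten_mapP[w wN].
rewrite inE => /orP[/eqP[-> ->]|]; last exact: IH.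
exists v, w; rewrite -(mem_port N) wN.
by split=> //; rewrite gathered_own.
Qed.

(** A round replaces the old list, yet nothing is lost: arcs leaving [v] are recorded anew, and an
    arc farther away is in the previous list of the first vertex after [v] on the walk towards
    it. *)
Lemma gathered_complete s t v x y : (s < t)%N -> within (@adj G) s v x ->
  adj x y -> (ident N x, ident N y) \in (st t v).2.
Proof.
elim: t s v => [//|t IH] s v.
rewrite ltnS => st_ [p [pP px] ps] xy.
rewrite /st /= -/st -map_comp; apply/flatten_mapP.
case: p pP px ps => [|w p] /= => [_ vx _|/andP[vw pP] px ps].
  exists y; first by rewrite mem_port vx.
  by rewrite inE !gathered_own vx eqxx.
exists w; first by rewrite mem_port.
rewrite inE (IH s.-1) ?orbT //.
  by rewrite (leq_trans _ st_) // prednK // (leq_trans _ ps).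
by exists p => //; rewrite -ltnS (leq_trans ps) // leqSpred.
Qed.

End Gathering.

Lemma gathering_output (R : realType) (G : simple_graph) (N : network G)
    (Dt eps : R) (v : G) : 0 < eps ->
  output_after (gathering_algorithm R) N (fun=> (#|G|, Dt, eps))
    (3 * radius #|G| eps) v =
  `[< detected (@adj G) (radius #|G| eps) (2 * ((1 - eps) * Dt)) v >].
Proof.
move=> e0; set r := radius _ _.
(* Arcs leaving vertices at distance [2 r] are known once [2 r < 3 r], which fails only for [r = 0].
   An edge forces two vertices, hence [ln #|G| > 0] and [r > 0]. *)
have r_gt0 (x y : G) : adj x y -> (0 < r)%N.
  move=> xy; rewrite lt0n; apply/eqP => r0.
  have G1 : (1 < #|G|)%N.
    have nxy : x != y by apply/eqP => E; rewrite E adj_irr in xy.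
    by have := max_card (mem [set x; y]); rewrite cards2 nxy.
  have := radius_ge #|G| eps; rewrite -/r r0 leNgt divr_gt0 //.
  by rewrite ln_gt0 // ltr1n.
rewrite /output_after /=.
have := gathered_own N (fun=> (#|G|, Dt, eps)) (3 * r)%N v.
have sound := @gathered_sound R G N (fun=> (#|G|, Dt, eps)) (3 * r)%N v.
have complete x y : within (@adj G) r.*2 v x -> adj x y ->
    (ident N x, ident N y) \in
      (state_after (gathering_algorithm R) N (fun=> (#|G|, Dt, eps)) (3 * r) v).2.
  move=> vx xy; have r0 := r_gt0 _ _ xy.
  by apply: gathered_complete vx xy; lia.
move: (state_after _ _ _ _ _) sound complete => /= -[ia known] /= sound complete ->.
apply: asbool_equiv_eq; apply: iff_sym.
exact: (detected_local _ (@adj_sym G) (@ident_inj _ N) sound complete).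
Qed.

Theorem theorem1 (R : realType) :
  exists (A : local_algorithm (dense_subgraph_input R) bool)
         (rounds : nat -> R -> R -> nat),
    solves_dense_subgraph A rounds /\
    exists C : R, forall (n : nat) (Dt eps : R),
      (0 < n)%N -> 0 <= Dt -> 0 < eps < 1 ->
      (rounds n Dt eps)%:R <= C * (ln n%:R / eps).
Proof.
exists (gathering_algorithm R), (fun n _ eps => 3 * radius n eps)%N.
(* [2 r + 1] rounds suffice; [3 r] is chosen because it is [0] for [n = 1],
   where [ln n = 0] leaves no round. *)
split.
  move=> G N Dt eps G0 _ eps01.
  rewrite (_ : output_after _ _ _ _ = fun v =>
     `[< detected (@adj G) (radius #|G| eps) (2 * ((1 - eps) * Dt)) v >]).
    exact: detected_solution.
  apply/funext => v; by apply: gathering_output; case/andP: eps01.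
(* The ceiling costs at most 3 extra rounds. For [n >= 2] the term [3 / ln 2] absorbs them, as
   [ln n / eps >= ln 2]; for [n = 1] both sides are 0. *)
exists (3 + 3 / ln 2) => n Dt eps n0 _ /andP[e0 e1].
have [->|n1] := eqVneq n 1%N.
  by rewrite /radius ln1 mul0r ceil0 muln0 mulr0.
have l2 : 0 < ln 2 :> R by rewrite ln_gt0 // ltr1n.
have ln2n : ln 2 <= ln n%:R / eps.
  rewrite ler_pdivlMr //.
  apply: le_trans (_ : ln 2 <= _); first by rewrite ler_piMr // ltW.
  rewrite ler_ln ?posrE ?ltr0n // ler_nat; case: n n0 n1 => [|[|]] //.
have := radius_lt n0 e0; rewrite natrM.
have : 3 <= 3 / ln 2 * (ln n%:R / eps).
  by rewrite -mulrA ler_peMr // mulrC ler_pdivlMr // mul1r.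
lra.
Qed.
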